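(* Let $E$ be a non-separable strong Gurariĭ space and let $\mathcal{G}$ be a skeleton in $E$. Then there exists $G\in\mathcal{G}$ that is not $1$-complemented in $E$.
   Context: All Banach spaces are real; isometric embeddings are always linear. A Banach space $X$ is a strong Gurariĭ space if for every pair of finite-dimensional Banach spaces $S\subseteq T$ and every isometric embedding $f\colon S\to X$ there exists an isometric embedding $g\colon T\to X$ with $g\restriction S=f$. A family $\mathcal{F}$ of closed linear subspaces of a Banach space $X$ is a skeleton in $X$ if: (1) each $F\in\mathcal{F}$ is separable; (2) $\bigcup\mathcal{F}=X$; (3) for every $F_0,F_1\in\mathcal{F}$ there exists $G\in\mathcal{F}$ such that $F_0\cup F_1\subseteq G$; (4) $\operatorname{cl}(\bigcup_{n\in\omega}F_n)\in\mathcal{F}$ whenever $\{F_n\}_{n\in\omega}$ is a countable chain in $\mathcal{F}$ (i.e. $F_0\subseteq F_1\subseteq\cdots$). A subspace $Y\subseteq X$ is $1$-complemented in $X$ if there is a linear projection $P\colon X\to X$ with $\|P\|\leq 1$ and image $Y$. *)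

(* Defs.v *)
From HB Require Import structures.
From mathcomp Require Import all_boot all_order all_algebra.
From mathcomp Require Import all_classical all_reals all_analysis.

Set Implicit Arguments.
Unset Strict Implicit.
Unset Printing Implicit Defensive.

Import Order.TTheory GRing.Theory Num.Theory.
Import numFieldNormedType.Exports.

Local Open Scope classical_set_scope.
Local Open Scope ring_scope.

(* A real Banach space is a [completeNormedModType R] with [R : realType]. *)

Definition finite_dimensional (R : realType) (V : lmodType R) : Prop :=
  exists n : nat, inhabited (Vector.axiom n V).

Definition closed_subspace (R : realType) (X : completeNormedModType R)
    (F : set X) : Prop :=
  submod_closed [in F] /\ closed F.

Definition separable_set (T : topologicalType) (A : set T) : Prop :=
  exists D : set T, [/\ countable D, D `<=` A & A `<=` closure D].

(* A map defined on a subspace [S] of [X] is represented by a total function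
   on [X], whose values outside [S] are irrelevant. *)
Definition isometric_embedding_on (R : realType)
    (X Y : completeNormedModType R) (S : set X) (f : X -> Y) : Prop :=
  (forall a : R, {in S &, forall u v, f (a *: u + v) = a *: f u + f v}) /\
  {in S, forall u, `|f u| = `|u|}.

(* [S] inherits its Banach space structure from [T]; being a subspace of a
   finite-dimensional space, it is finite-dimensional and closed. *)
Definition strong_gurarii (R : realType) (X : completeNormedModType R) : Prop :=
  forall (T : completeNormedModType R) (S : set T),
    finite_dimensional T -> submod_closed [in S] ->
  forall f : T -> X, isometric_embedding_on S f ->
  exists2 g : T -> X, isometric_embedding_on setT g & {in S, g =1 f}.

Definition skeleton (R : realType) (X : completeNormedModType R)
    (FF : set (set X)) : Prop :=
  [/\ forall F, FF F -> closed_subspace F /\ separable_set F,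
      \bigcup_(F in FF) F = setT,
      forall F0 F1, FF F0 -> FF F1 -> exists2 G, FF G & F0 `|` F1 `<=` G &
      forall F : nat -> set X,
        (forall n, FF (F n)) -> (forall n, F n `<=` F n.+1) ->
        FF (closure (\bigcup_n F n))].

(* The operator norm bound [||P|| <= 1] is written pointwise. *)
Definition one_complemented (R : realType) (X : completeNormedModType R)
    (Y : set X) : Prop :=
  exists P : {linear X -> X},
    [/\ forall x, P (P x) = P x,
        forall x, `|P x| <= `|x| &
        range P = Y].

(* Main.v *)
Require Import Defs.
From HB Require Import structures.
From mathcomp Require Import all_boot all_order all_algebra.
From mathcomp Require Import all_classical all_reals all_analysis.
From mathcomp Require Import ring lra.

Set Implicit Arguments.
Unset Strict Implicit.
Unset Printing Implicit Defensive.

Import Order.TTheory GRing.Theory Num.Theory.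
Import numFieldNormedType.Exports.

Local Open Scope classical_set_scope.
Local Open Scope ring_scope.

(** Why the theorem holds. A strong Gurarii space [E] contains a Euclidean
plane, spanned by some [e1] and [e2], and a skeleton has a member [G] that
contains both. Suppose, for a contradiction, that [P] is a norm-one projection of [E] onto [G]; in
particular [P] fixes the plane pointwise.

For every line [L] in the plane, the plane embeds isometrically in a
three-dimensional space where an additional vector [y] produces a jump along
[L]: at a vector [v] of the plane, the norm of [v + t y] is [|v| + t] for
small [t] if [v] lies strictly on one side of [L], and [|v| - t] if it lies
strictly on the other side ([kinked_slope]). As [E] is a strong Gurarii space,
it contains such a [y], exactly and not merely approximately, on top of the
given plane ([strong_gurarii_kink]). Put [z := P y]. Since [P] fixes [v] and
has norm at most one, [|v + t z| <= |v| + t], respectively [|v| - t], for all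
small [t] of either sign.

Let [L], [L'] be distinct lines, with vectors [z], [z'] in [G], and choose [v]
strictly between them, on the increasing side for [L] and on the decreasing
side for [L']. Both [v - e z] and [v + e z'] then have norm at most [|v| - e]
for a small [e > 0]; as they add up to [2 v - e (z - z')], this forces
[|z - z'| >= 2] ([opposite_slopes_separated]). There are uncountably many
lines, so [G] contains an uncountable 2-separated set and cannot be separable
([separable_no_uncountable_separation]). *)

(** * A norm on three-space with a jump along a line *)

Section KinkedSpace.
Variable R : realType.
Implicit Types (a b c d t : R).

(** The distance from [(a, b)] to the ray of the vectors [(0, - r)], [r >= 0],
in the Euclidean plane: a seminorm, except that it is homogeneous for
nonnegative scalars only. *)
Definition half_norm a b : R := Num.sqrt (a ^+ 2 + Num.max b 0 ^+ 2).

Lemma sqrt_le_of_sqr x y : 0 <= y -> x <= y ^+ 2 -> Num.sqrt x <= y :> R.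
Proof. by move=> y0 xy; rewrite -(ger0_norm y0) -sqrtr_sqr ler_wsqrtr. Qed.

Lemma sqrt_minkowski a b c d :
  Num.sqrt ((a + c) ^+ 2 + (b + d) ^+ 2) <=
  Num.sqrt (a ^+ 2 + b ^+ 2) + Num.sqrt (c ^+ 2 + d ^+ 2).
Proof.
have pos x y : 0 <= x ^+ 2 + y ^+ 2 :> R by rewrite addr_ge0 ?sqr_ge0.
apply: sqrt_le_of_sqr; first by rewrite addr_ge0 ?sqrtr_ge0.
(* Cauchy-Schwarz, from the square of the determinant *)
have cs : a * c + b * d <=
    Num.sqrt (a ^+ 2 + b ^+ 2) * Num.sqrt (c ^+ 2 + d ^+ 2).
  rewrite -sqrtrM //; apply: (le_trans (ler_norm _)).
  rewrite -sqrtr_sqr ler_wsqrtr //.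
  by have := sqr_ge0 (a * d - b * c); nra.
by rewrite [leRHS]sqrrD !sqr_sqrtr //; nra.
Qed.

Lemma half_normD a b c d :
  half_norm (a + c) (b + d) <= half_norm a b + half_norm c d.
Proof.
apply: le_trans (sqrt_minkowski _ _ _ _).
rewrite ler_wsqrtr // lerD2l ler_sqr ?nnegrE ?addr_ge0 ?le_max ?lexx ?orbT //.
by rewrite ge_max lerD ?addr_ge0 ?le_max ?lexx ?orbT.
Qed.

Lemma half_normZ c a b : 0 <= c -> half_norm (c * a) (c * b) = c * half_norm a b.
Proof.
move=> c0; rewrite /half_norm.
have -> : Num.max (c * b) 0 = c * Num.max b 0 by rewrite maxr_pMr // mulr0.
rewrite !exprMn -mulrDr.
by rewrite sqrtrM ?sqr_ge0 // sqrtr_sqr ger0_norm.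
Qed.

Lemma half_norm_sym a b : half_norm (- a) b = half_norm a b.
Proof. by rewrite /half_norm sqrrN. Qed.

Lemma half_norm_pos a b : 0 <= b -> half_norm a b = Num.sqrt (a ^+ 2 + b ^+ 2).
Proof. by move=> b0; rewrite /half_norm max_l. Qed.

Lemma half_norm_neg a b : b <= 0 -> half_norm a b = `|a|.
Proof. by move=> b0; rewrite /half_norm max_r // expr0n addr0 sqrtr_sqr. Qed.

Lemma half_norm_ge_fst a b : `|a| <= half_norm a b.
Proof. by rewrite -sqrtr_sqr ler_wsqrtr // lerDl sqr_ge0. Qed.

Lemma half_norm_ge_snd a b : b <= half_norm a b.
Proof.
apply: (@le_trans _ _ `|Num.max b 0|).
  by rewrite (le_trans _ (ler_norm _)) // le_max lexx.
by rewrite -sqrtr_sqr ler_wsqrtr // lerDr sqr_ge0.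
Qed.

(** An alias, because the product type already carries the maximum norm. *)
Definition kinked : Type := (R^o * R^o * R^o)%type.
HB.instance Definition _ := GRing.Lmodule.copy kinked (R^o * R^o * R^o)%type.

(** Each functional on the plane of Euclidean norm at most one whose second coordinate is
nonnegative is extended by the value 1 on [(0, 0, 1)]; the norm of [p] is the
largest absolute value at [p] of these extensions. The plane keeps its
Euclidean norm because such functionals and their opposites fill the dual
ball, while the value at [(0, 0, 1)] jumps from 1 to -1 when the norming
functional crosses the first axis. *)
Definition kinked_norm (p : kinked) : R :=
  Num.max (half_norm p.1.1 p.1.2 + p.2) (half_norm p.1.1 (- p.1.2) - p.2).

Lemma kinked_normD (p r : kinked) :
  kinked_norm (p + r) <= kinked_norm p + kinked_norm r.
Proof.
rewrite /kinked_norm ge_max; apply/andP; split.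
  apply: (@le_trans _ _ ((half_norm p.1.1 p.1.2 + p.2) +
                         (half_norm r.1.1 r.1.2 + r.2))).
    by rewrite addrACA lerD2r half_normD.
  by rewrite lerD // le_max lexx.
apply: (@le_trans _ _ ((half_norm p.1.1 (- p.1.2) - p.2) +
                       (half_norm r.1.1 (- r.1.2) - r.2))).
  by rewrite addrACA -opprD lerD2r /= opprD half_normD.
by rewrite lerD // le_max lexx orbT.
Qed.

Lemma kinked_normN (p : kinked) : kinked_norm (- p) = kinked_norm p.
Proof. by rewrite /kinked_norm /= !half_norm_sym !opprK maxC. Qed.

Lemma kinked_normZ (c : R) (p : kinked) :
  kinked_norm (c *: p) = `|c| * kinked_norm p.
Proof.
wlog c0 : c / 0 <= c => [hw|].
  have [/hw//|/ltW c0] := leP 0 c.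
  by rewrite -normrN -hw ?oppr_ge0 // scaleNr kinked_normN.
rewrite ger0_norm // maxr_pMr // mulrDr mulrBr -!half_normZ //.
by rewrite mulrN.
Qed.

(** This and [kinked_norm_le] compare the norm with the coordinates, which
yields completeness. *)
Lemma kinked_norm_bound (p : kinked) :
  [/\ `|p.1.1| <= 2 * kinked_norm p, `|p.1.2| <= 2 * kinked_norm p &
      `|p.2| <= 2 * kinked_norm p].
Proof.
case: p => -[a b] t; rewrite /kinked_norm /=.
have [ha ha'] := (half_norm_ge_fst a b, half_norm_ge_fst a (- b)).
have [hb hb'] := (half_norm_ge_snd a b, half_norm_ge_snd a (- b)).
set N := Num.max _ _.
have hN : half_norm a b + t <= N by rewrite le_max lexx.
have hN' : half_norm a (- b) - t <= N by rewrite le_max lexx orbT.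
have a0 := normr_ge0 a.
clearbody N; split; last 2 first.
- by rewrite ler_norml; apply/andP; split; lra.
- by rewrite ler_norml; apply/andP; split; lra.
- lra.
Qed.

Lemma half_norm_le a b : half_norm a b <= `|a| + `|b|.
Proof.
apply: sqrt_le_of_sqr; first by rewrite addr_ge0.
have m : `|Num.max b 0| <= `|b|.
  by rewrite ger0_norm ?le_max ?lexx ?orbT // ge_max ler_norm normr_ge0.
rewrite -ler_sqr ?nnegrE // !real_normK ?num_real // in m.
have [a2 b2] := (real_normK (num_real a), real_normK (num_real b)).
have [a0 b0] := (normr_ge0 a, normr_ge0 b).
by rewrite sqrrD a2 b2; nra.
Qed.

Lemma kinked_norm_le (p : kinked) :
  kinked_norm p <= `|p.1.1| + `|p.1.2| + `|p.2|.
Proof.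
rewrite /kinked_norm ge_max lerD ?half_norm_le ?ler_norm //=.
by rewrite lerD ?(le_trans (half_norm_le _ _)) ?normrN // -normrN ler_norm.
Qed.

Lemma kinked_norm0_eq0 (p : kinked) : kinked_norm p = 0 -> p = 0.
Proof.
have [] := kinked_norm_bound p => + + + p0; rewrite p0 mulr0 !normr_le0.
by case: p {p0} => -[a b] t /= /eqP -> /eqP -> /eqP ->.
Qed.

HB.instance Definition _ :=
  Lmodule_isNormed.Build R kinked kinked_normD kinked_normZ kinked_norm0_eq0.

End KinkedSpace.

(** * Completeness and finite dimension *)

Lemma cauchy_lipschitz_image (R : realFieldType) (V W : normedModType R)
    (f : V -> W) (k : R) (F : set_system V) {FF : ProperFilter F} :
  (forall x y, `|f x - f y| <= k * `|x - y|) -> cauchy F -> cauchy (f @ F).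
Proof.
move=> fk /cauchyP Fc; apply/cauchyP => e e0.
have k1 : 0 < `|k| + 1 by rewrite ltr_wpDl.
have [x Fx] := Fc (e / (`|k| + 1)) (divr_gt0 e0 k1).
exists (f x); apply: (filterS _ Fx : F (f @^-1` _)) => y.
rewrite -!ball_normE /ball_ /= ltr_pdivlMr // => xy.
apply: le_lt_trans (fk _ _) _.
apply: le_lt_trans xy; rewrite [leRHS]mulrC ler_wpM2r //.
by rewrite (le_trans (ler_norm k)) // lerDl.
Qed.

Lemma kinked_complete (R : realType) (F : set_system (kinked R)) :
  ProperFilter F -> cauchy F -> cvg F.
Proof.
move=> FF Fc.
have coord_cvg (f : kinked R -> R) : (forall x y, f (x - y) = f x - f y) ->
    (forall x, `|f x| <= 2 * `|x|) -> exists l : R, f @ F --> l.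
  move=> fB f2; suff /R_complete fc : cauchy (f @ F) by exists (lim (f @ F)).
  apply: (@cauchy_lipschitz_image _ _ R^o f 2) => // x y.
  by rewrite -fB f2.
have [a Fa] : exists a : R, (fun p : kinked R => p.1.1 : R) @ F --> a.
  by apply: coord_cvg => // x; have [] := kinked_norm_bound x.
have [b Fb] : exists b : R, (fun p : kinked R => p.1.2 : R) @ F --> b.
  by apply: coord_cvg => // x; have [] := kinked_norm_bound x.
have [t Ft] : exists t : R, (fun p : kinked R => p.2 : R) @ F --> t.
  by apply: coord_cvg => // x; have [] := kinked_norm_bound x.
apply/cvg_ex; exists ((a, b, t) : kinked R).
apply/cvgrPdist_le => e e0.
have e3 : 0 < e / 3 by rewrite divr_gt0.
move/cvgrPdist_le: Fa => /(_ _ e3) Na.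
move/cvgrPdist_le: Fb => /(_ _ e3) Nb.
move/cvgrPdist_le: Ft => /(_ _ e3) Nt.
suff : forall p : kinked R, `|a - p.1.1| <= e / 3 -> `|b - p.1.2| <= e / 3 ->
    `|t - p.2| <= e / 3 -> `|((a, b, t) : kinked R) - p| <= e.
  by move=> h; apply: filterS3 h Na Nb Nt.
move=> p pa pb pt.
rewrite -[X in X <= _]/(kinked_norm _); apply: (le_trans (kinked_norm_le _)).
by rewrite /=; lra.
Qed.

HB.instance Definition _ (R : realType) :=
  Uniform_isComplete.Build (kinked R) (@kinked_complete R).

Lemma vect_finite_dimensional (R : realType) (V : vectType R) :
  finite_dimensional V.
Proof.
have [f [fZ fD] fb] := VectorInternalTheory.v2r_subproof V.
by exists (dim V); constructor; exists f => // a u v; rewrite fD fZ.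
Qed.

Lemma kinked_finite_dimensional (R : realType) :
  finite_dimensional (kinked R).
Proof. exact: (@vect_finite_dimensional R (R^o * R^o * R^o)%type). Qed.

Lemma kinked_eq (R : realType) (p r : kinked R) :
  p.1.1 = r.1.1 -> p.1.2 = r.1.2 -> p.2 = r.2 -> p = r.
Proof. by case: p r => -[a b] t [[a' b'] t'] /= -> -> ->. Qed.

(** * The jump of the norm *)

Section KinkedNorm.
Variable R : realType.
Implicit Types a b t : R.

Lemma kinked_normE a b t : `|((a, b, t) : kinked R)| =
  Num.max (half_norm a b + t) (half_norm a (- b) - t).
Proof. by []. Qed.

Lemma kinked_euclidean a b :
  `|((a, b, 0) : kinked R)| = Num.sqrt (a ^+ 2 + b ^+ 2).
Proof.
rewrite kinked_normE subr0 addr0.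
have [b0|b0] := leP 0 b.
  rewrite half_norm_pos // half_norm_neg ?oppr_le0 // max_l //.
  by rewrite -sqrtr_sqr ler_wsqrtr // lerDl sqr_ge0.
rewrite half_norm_neg ?(ltW b0) // half_norm_pos ?oppr_ge0 ?(ltW b0) //.
rewrite sqrrN max_r //.
by rewrite -sqrtr_sqr ler_wsqrtr // lerDl sqr_ge0.
Qed.

Lemma kinked_reflect a b t :
  `|((a, - b, - t) : kinked R)| = `|((a, b, t) : kinked R)|.
Proof. by rewrite !kinked_normE !opprK maxC. Qed.

(** Off the first axis, one of the two terms of the maximum is strictly
larger at [t = 0], so it remains the larger one for small [t] of both signs.
The case [b < 0] follows by [kinked_reflect]. *)
Lemma kinked_slope a b : 0 < b -> exists2 e, 0 < e & forall t, `|t| <= e ->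
  `|((a, b, t) : kinked R)| = `|((a, b, 0) : kinked R)| + t.
Proof.
move=> b0; pose h := Num.sqrt (a ^+ 2 + b ^+ 2).
have ah : `|a| < h.
  by rewrite -sqrtr_sqr ltr_sqrt ?ltrDl ?exprn_gt0 // ltr_wpDl ?sqr_ge0 ?exprn_gt0.
(* half the gap between the two terms at t = 0, which are h and |a| *)
exists ((h - `|a|) / 2); first by rewrite divr_gt0 ?subr_gt0.
move=> t; rewrite ler_norml => /andP[t1 t2].
rewrite kinked_euclidean kinked_normE half_norm_pos ?(ltW b0) //.
rewrite half_norm_neg ?oppr_le0 ?(ltW b0) // -/h max_l //.
lra.
Qed.

End KinkedNorm.

(** * Uncountable separated families *)

(** The vectors [v - e z] and [v + e z'] add up to [2 v - e (z - z')], whose norm is at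
least [2 |v| - e |z - z'|]. *)
Lemma opposite_slopes_separated (R : realType) (V : normedModType R)
    (v z z' : V) (e : R) : 0 < e ->
  `|v - e *: z| <= `|v| - e -> `|v + e *: z'| <= `|v| - e -> 2 <= `|z - z'|.
Proof.
move=> e0 h h'.
have : `|(v + v) - e *: (z - z')| <= (`|v| - e) + (`|v| - e).
  apply: le_trans (lerD h h'); apply: le_trans (ler_normD _ _).
  by rewrite scalerBr opprB addrACA addrC.
have := lerB_dist (v + v) (e *: (z - z')).
have -> : `|v + v| = `|v| + `|v| by rewrite -mulr2n normrMn mulr2n.
rewrite normrZ (gtr0_norm e0) => h1 h2.
have : e * 2 <= e * `|z - z'| by lra.
by rewrite ler_pM2l.
Qed.

Lemma uncountable_real (R : realType) : ~ countable [set: R].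
Proof.
move=> /countable_lebesgue_measure0; rewrite -set_itvNyy.
by rewrite lebesgue_measure_itv.
Qed.

(** Balls of radius 1 around the [z u] each contain a point of the countable
dense set, and no point lies in two of them, so the reals would inject into a
countable set. *)
Lemma separable_no_uncountable_separation (R : realType) (V : normedModType R)
    (G : set V) (z : R -> V) : separable_set G -> (forall u, G (z u)) ->
  ~ (forall u v, u < v -> 2 <= `|z u - z v|).
Proof.
move=> [D [Dc _ GD]] Gz sep; apply: (@uncountable_real R).
have near_D u : exists d, D d /\ `|z u - d| < 1.
  have [d [Dd]] := GD _ (Gz u) _ (nbhsx_ballx _ 1 ltr01).
  by rewrite -ball_normE; exists d.
have [d dP] := choice near_D.
have inj u v : d u = d v -> ~ u < v.
  move=> duv uv; have := sep u v uv.
  apply/negP; rewrite -ltNge.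
  rewrite (_ : z u - z v = (z u - d u) - (z v - d v)); last first.
    by rewrite duv opprB addrA subrK.
  apply: le_lt_trans (ler_normB _ _) _.
  by have [[_ h] [_ h']] := (dP u, dP v); lra.
have /countable_injP[f finj] := Dc.
apply/countable_injP; exists (f \o d) => u v _ _ /= fduv.
have duv : d u = d v.
  by apply: finj fduv; rewrite inE; [have [] := dP u|have [] := dP v].
by have [/(inj _ _ duv)|/(inj _ _ (esym duv))|] := ltgtP u v.
Qed.

(** * Kinks over a Euclidean plane in a strong Gurarii space *)

(** The kinked space contains a Euclidean plane, and extending the zero map
from its zero subspace embeds it in [E]. *)
Lemma strong_gurarii_euclidean_plane (R : realType)
    (E : completeNormedModType R) : strong_gurarii E ->
  exists e1 e2 : E, forall a b,
    `|a *: e1 + b *: e2| = Num.sqrt (a ^+ 2 + b ^+ 2).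
Proof.
move=> SG.
have [||g [gl gn] _] := SG (kinked R) [set 0] (@kinked_finite_dimensional R)
  _ (fun=> 0).
- split=> [|a x y]; rewrite !inE /=; first by [].
  by move=> -> ->; rewrite scaler0 addr0.
- split=> [a x y _ _|x]; first by rewrite scaler0 addr0.
  by rewrite inE /= => ->; rewrite !normr0.
exists (g (1, 0, 0)), (g (0, 1, 0)) => a b.
have lin c (x y : kinked R) : g (c *: x + y) = c *: g x + g y.
  by apply: gl; rewrite inE.
have g0 : g 0 = 0.
  have := lin 1 0 0; rewrite !scale1r addr0 => /eqP.
  by rewrite -subr_eq subrr => /eqP.
have gZ c x : g (c *: x) = c *: g x by have := lin c x 0; rewrite g0 !addr0.
rewrite -(gZ b) -lin gn ?inE // -kinked_euclidean; congr (`|_|).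
by apply: kinked_eq; rewrite /= ?scaler1 ?scaler0 ?add0r ?addr0.
Qed.

(** The kinked space is glued to the given plane along the orthonormal frame
[c e1 + d e2], [c e2 - d e1], so that the jump occurs along the line of
direction [(c, d)]. The coordinates of [a e1 + b e2] in this frame are
[c a + d b] and [c b - d a]. *)
Lemma strong_gurarii_kink (R : realType) (E : completeNormedModType R)
    (e1 e2 : E) (c d : R) : strong_gurarii E ->
  (forall a b, `|a *: e1 + b *: e2| = Num.sqrt (a ^+ 2 + b ^+ 2)) ->
  c ^+ 2 + d ^+ 2 = 1 ->
  exists y : E, forall a b t, `|a *: e1 + b *: e2 + t *: y| =
    `|((c * a + d * b, c * b - d * a, t) : kinked R)|.
Proof.
move=> SG plane cd.
pose s := c *: e1 + d *: e2; pose x := (- d) *: e1 + c *: e2.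
have frame a b : a *: s + b *: x = (a * c - b * d) *: e1 + (a * d + b * c) *: e2.
  by rewrite !scalerDr !scalerA addrACA -!scalerDl mulrN.
pose f (p : kinked R) : E := p.1.1 *: s + p.1.2 *: x.
have flin a (p r : kinked R) : f (a *: p + r) = a *: f p + f r.
  by rewrite /f /= !scalerDl [in RHS]scalerDr [in RHS]scalerA [in RHS]scalerA addrACA.
have [||g [gl gn] gf] := SG (kinked R) [set p | p.2 = 0]
    (@kinked_finite_dimensional R) _ f.
- split=> [|a p r]; rewrite !inE //= => -> ->.
  by rewrite scaler0 addr0.
- split=> [a p r _ _|[[a b] t]]; first exact: flin.
  rewrite inE /= => ->; rewrite /f /= frame plane kinked_euclidean.
  congr (Num.sqrt _); rewrite -[RHS]mul1r -cd; ring.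
exists (g (0, 0, 1)) => a b t.
have := gn (c * a + d * b, c * b - d * a, t); rewrite inE => <- //.
congr (`|_|).
have -> : ((c * a + d * b, c * b - d * a, t) : kinked R) =
   t *: ((0, 0, 1) : kinked R) + (c * a + d * b, c * b - d * a, 0).
  by apply: kinked_eq; rewrite /= ?scaler1 ?scaler0 ?add0r ?addr0.
rewrite gl ?inE // addrC; congr (_ + _).
rewrite gf ?inE // /f /= frame.
have -> : (c * a + d * b) * c - (c * b - d * a) * d = (c ^+ 2 + d ^+ 2) * a by ring.
have -> : (c * a + d * b) * d + (c * b - d * a) * c = (c ^+ 2 + d ^+ 2) * b by ring.
by rewrite cd !mul1r.
Qed.

Theorem theorem5p3 (R : realType) (E : completeNormedModType R)
    (GG : set (set E)) :
  ~ separable_set [set: E]%classic ->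
  strong_gurarii E ->
  skeleton GG ->
  exists G : set E, GG G /\ ~ one_complemented G.
Proof.
move=> _ SG [GGsep GGcover GGdir _].
have [e1 [e2 plane]] := strong_gurarii_euclidean_plane SG.
have [G1 GG1 G1e] : (\bigcup_(F in GG) F) e1 by rewrite GGcover.
have [G2 GG2 G2e] : (\bigcup_(F in GG) F) e2 by rewrite GGcover.
have [G GGG G12] := GGdir _ _ GG1 GG2.
exists G; split=> // -[P [PP Pn PG]].
have PK w : G w -> P w = w by rewrite -PG => -[v _ <-]; rewrite PP.
have Pe1 : P e1 = e1 by apply: PK; apply: G12; left.
have Pe2 : P e2 = e2 by apply: PK; apply: G12; right.
(* The line with slope u has the unit direction (1 / r u, u / r u). *)
pose r u : R := Num.sqrt (1 + u ^+ 2).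
have r0 u : 0 < r u by rewrite sqrtr_gt0 ltr_wpDr ?sqr_ge0.
have unit_uv u : (r u)^-1 ^+ 2 + (u / r u) ^+ 2 = 1.
  rewrite expr_div_n exprVn sqr_sqrtr ?addr_ge0 ?sqr_ge0 //.
  by rewrite -[X in X + _]mul1r -mulrDl divff // gt_eqF // ltr_wpDr ?sqr_ge0.
have [y yP] := choice (fun u => strong_gurarii_kink SG plane (unit_uv u)).
have Gz u : G (P (y u)) by rewrite -PG; exists (y u).
have [_ Gsep] := GGsep _ GGG.
apply: (separable_no_uncountable_separation Gsep Gz) => u w uw.
have projected a b t v : `|a *: e1 + b *: e2 + t *: P (y v)| <=
    `|a *: e1 + b *: e2 + t *: y v|.
  by apply: le_trans (Pn _); rewrite !linearD !linearZ /= Pe1 Pe2.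
(* The test vector has slope strictly between u and w. *)
pose m := (u + w) / 2; pose v := 1 *: e1 + m *: e2.
have side k : (r k)^-1 * m - k / r k * 1 = (m - k) / r k.
  by rewrite mulr1 mulrBl mulrC.
(* coordinates of v along and across the line with slope k *)
pose along k := (r k)^-1 * 1 + k / r k * m.
pose across k := (r k)^-1 * m - k / r k * 1.
have vE k : `|v| = `|((along k, across k, 0) : kinked R)|.
  by rewrite -yP scale0r addr0.
have um : 0 < across u by rewrite /across side divr_gt0 // subr_gt0 midf_lt.
have mw : 0 < - across w.
  by rewrite /across side -mulNr opprB divr_gt0 // subr_gt0 midf_lt.
have [p p0 hp] := kinked_slope (along u) um.
have [q q0 hq] := kinked_slope (along w) mw.
pose e := Num.min p q.
have e0 : 0 < e by rewrite lt_min p0.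
apply: (opposite_slopes_separated (v := v) e0).
- rewrite -scaleNr; apply: le_trans (projected _ _ _ _) _.
  by rewrite yP hp -?vE // normrN gtr0_norm // ge_min lexx.
- apply: le_trans (projected _ _ _ _) _.
  rewrite yP -kinked_reflect hq; last first.
    by rewrite normrN gtr0_norm // ge_min lexx orbT.
  by rewrite -[X in (_, _, X)]oppr0 kinked_reflect -vE.
Qed.
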